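(* There are absolute constants $c, C>0$ such that for every integer $d \geq 4$ there exists a set $\mathcal{H}$ of hyperplanes in $\mathbb{R}^d$ with $$c\, d^2 \log d \;\leq\; \operatorname{vcdim}\left(\Delta(\mathcal{H})\right) \;\leq\; C\, d^2\log d,$$ i.e. $\operatorname{vcdim}(\Delta(\mathcal{H})) = \Theta(d^2 \log d)$.
   Context: For a set $\mathcal{H}$ of hyperplanes in $\mathbb{R}^d$, define the set system on ground set $\mathcal{H}$ $$\Delta(\mathcal{H}) = \{ H \subseteq \mathcal{H} : \text{there is an open } d\text{-dimensional simplex } \Delta \subset \mathbb{R}^d \text{ such that } H = \{h \in \mathcal{H} : h \cap \Delta \neq \emptyset\}\}.$$ For a set system $(X,\mathcal{R})$ and $Y \subseteq X$, $\mathcal{R}$ shatters $Y$ if $\{Y \cap R : R \in \mathcal{R}\}$ is the full power set of $Y$; $\operatorname{vcdim}(\mathcal{R})$ is the largest size of a subset of $X$ shattered by $\mathcal{R}$. Logarithms are base 2. *)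

(* Defs.v *)
From HB Require Import structures.
From Stdlib Require Import Rdefinitions Rpower.
From mathcomp Require Import all_boot all_order all_algebra.
From mathcomp Require Import Rstruct.
Set Implicit Arguments. Unset Strict Implicit. Unset Printing Implicit Defensive.
Import Order.TTheory GRing.Theory Num.Theory.
Local Open Scope ring_scope.

Notation R := Rdefinitions.R.

Definition point (d : nat) := 'rV[R]_d.

Definition dotp d (u v : point d) : R := \sum_(i < d) u 0 i * v 0 i.

Definition is_hyperplane d (h : point d -> Prop) : Prop :=
  exists (a : point d) (b : R), a != 0 /\ forall x, h x <-> dotp a x = b.

Definition aff_indep d (v : 'I_d.+1 -> point d) : Prop :=
  forall mu : 'I_d.+1 -> R,
    \sum_i mu i = 0 -> \sum_i mu i *: v i = 0 -> forall i, mu i = 0.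

Definition open_simplex_of d (v : 'I_d.+1 -> point d) (x : point d) : Prop :=
  exists lam : 'I_d.+1 -> R,
    (forall i, 0 < lam i) /\ \sum_i lam i = 1 /\ x = \sum_i lam i *: v i.

Definition is_open_simplex d (D : point d -> Prop) : Prop :=
  exists v : 'I_d.+1 -> point d, aff_indep v /\ forall x, D x <-> open_simplex_of v x.

Definition meets d (h D : point d -> Prop) : Prop := exists x, h x /\ D x.

(* Y (a duplicate-free finite list of elements of H) is shattered by Delta(H):
   every subset P of Y is the trace on Y of {h in H : h meets Delta}
   for some open simplex Delta. *)
Definition simplex_shatters d (H : (point d -> Prop) -> Prop)
    (Y : list (point d -> Prop)) : Prop :=
  List.NoDup Y /\ (forall h, List.In h Y -> H h) /\
  forall P : (point d -> Prop) -> Prop,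
    exists D, is_open_simplex D /\
      forall h, List.In h Y -> (meets h D <-> P h).

Definition log2 (x : R) : R := Rpower.ln x / Rpower.ln 2.

(* Main.v *)
Require Import Defs.
From HB Require Import structures.
From Stdlib Require List Rpower.
From mathcomp Require Import all_boot all_order all_algebra.
From mathcomp Require Import Rstruct boolp ring lra zify.
Import Order.TTheory GRing.Theory Num.Theory.
Local Open Scope ring_scope.
Set Implicit Arguments. Unset Strict Implicit. Unset Printing Implicit Defensive.

(* A hyperplane meets an open simplex iff it strictly separates two vertices, so a
   simplex with one vertex on the positive side of every hyperplane meets exactly
   those having another vertex on their negative side.  Since H may be taken finite,
   of size Theta(d^2 log d), it suffices to shatter it.

   Take k = 2^(n+1) <= d.  A butterfly network maps z in {0,1}^(n+1) to x(z) by
   xoring bit i, for i = 0, 1, ..., n, with a switch s(i, x_0 .. x_(i-1), z_(i+1) .. z_n).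
   The dyadic box of (i, w), w_i = 0, asks that x agrees with w up to position i and
   z agrees with w from position i on; it contains one of the k planar points
   (x(z), z) iff the switch s(i, w) is off.  The (n+1) 2^n switches being free, these
   boxes are shattered by k points of the plane.  Written in base 4, the boxes can be
   replaced by axis-parallel ellipses, which are half-spaces in the coordinates
   (X^2, X, Z^2, Z).  Placing floor(d/4) copies in disjoint blocks of four coordinates
   yields floor(d/4) (n+1) 2^n shattered hyperplanes; a small perturbation makes the
   vertices affinely independent. *)

Lemma weighted_sum_eq0_pos_term (F : realFieldType) (I : finType) (lam s : I -> F)
    (p : I) :
  (forall i, 0 < lam i) -> \sum_i lam i * s i = 0 -> s p != 0 ->
  exists i, 0 < s i.
Proof.
move=> lam_gt0 sum0 sp0; apply/existsP; apply: contraT => /existsPn s_le0.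
have terms_ge0 i : true -> 0 <= - (lam i * s i).
  by move=> _; rewrite oppr_ge0 pmulr_rle0 // leNgt s_le0.
have := psumr_eq0P terms_ge0; rewrite sumrN sum0 oppr0 => /(_ erefl p isT)/eqP.
by rewrite oppr_eq0 mulf_eq0 (negPf sp0) gt_eqF.
Qed.

Lemma exists_weights_sum_eq0 (F : realFieldType) (I : finType) (s : I -> F) (p q : I) :
  0 < s p -> s q < 0 ->
  exists2 w : I -> F, forall i, 0 < w i & \sum_i w i * s i = 0.
Proof.
move=> sp sq.
have increase_weight j : s j != 0 -> 0 <= - (\sum_i s i) / s j ->
    exists2 w : I -> F, forall i, 0 < w i & \sum_i w i * s i = 0.
  move=> sj0 c_ge0.
  exists (fun i => 1 + (i == j)%:R * (- (\sum_i s i) / s j)) => [i|].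
    by rewrite ltr_wpDr // mulr_ge0.
  under eq_bigr do rewrite mulrDl mul1r -mulrA mulr_natl mulrb.
  by rewrite big_split /= -big_mkcond big_pred1_eq divfK // subrr.
have [sum_ge0|sum_lt0] := leP 0 (\sum_i s i).
  apply: (increase_weight q); first by rewrite lt_eqF.
  by rewrite mulNr oppr_ge0 mulr_ge0_le0 // invr_le0 ltW.
by apply: (increase_weight p); rewrite ?gt_eqF // divr_ge0 ?oppr_ge0 // ltW.
Qed.

Lemma convex_combination_eq0P (F : realFieldType) (I : finType) (s : I -> F) (p : I) :
  s p != 0 ->
  (exists lam : I -> F,
    [/\ forall i, 0 < lam i, \sum_i lam i = 1 & \sum_i lam i * s i = 0]) <->
  (exists i, 0 < s i) /\ (exists i, s i < 0).
Proof.
move=> sp0; split=> [[lam [lam_gt0 _ sum0]]|[[i si] [j sj]]].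
  split; first exact: weighted_sum_eq0_pos_term sum0 sp0.
  have [||i] := @weighted_sum_eq0_pos_term _ _ lam (fun i => - s i) p lam_gt0.
  - by under eq_bigr do rewrite mulrN; rewrite sumrN sum0 oppr0.
  - by rewrite oppr_eq0.
  - by rewrite oppr_gt0; exists i.
have [w w_gt0 sum0] := exists_weights_sum_eq0 si sj.
have total_gt0 : 0 < \sum_i w i.
  by rewrite (bigD1 p) //= ltr_wpDr // sumr_ge0 // => k _; apply: ltW.
exists (fun k => w k / \sum_i w i); split=> [k||].
- exact: divr_gt0.
- by rewrite -mulr_suml divff // gt_eqF.
- by under eq_bigr do rewrite mulrAC; rewrite -mulr_suml sum0 mul0r.
Qed.

(** * Hyperplanes and open simplices *)

Lemma dotp_is_linear d (a : point d) : scalar (dotp a).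
Proof.
move=> t x y; rewrite /dotp mulr_sumr -big_split /=; apply: eq_bigr => i _.
by rewrite !mxE mulrDr mulrCA.
Qed.

HB.instance Definition _ d (a : point d) :=
  GRing.isLinear.Build R (point d) R _ (dotp a) (dotp_is_linear a).

Definition hyperplane d (h : point d * R) : point d -> Prop :=
  fun x => dotp h.1 x = h.2.

Definition side d (h : point d * R) (x : point d) : R := dotp h.1 x - h.2.

Lemma hyperplaneE d (h : point d * R) x : hyperplane h x <-> side h x = 0.
Proof. by rewrite /side; split=> [->|/subr0_eq //]; rewrite subrr. Qed.

Lemma side_convex_combination d (h : point d * R) (I : finType) (lam : I -> R)
    (v : I -> point d) :
  \sum_i lam i = 1 -> side h (\sum_i lam i *: v i) = \sum_i lam i * side h (v i).
Proof.
move=> lam1; under [RHS]eq_bigr do rewrite mulrBr.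
rewrite sumrB -mulr_suml lam1 mul1r /side linear_sum; congr (_ - _).
by apply: eq_bigr => i _; rewrite linearZ.
Qed.

Lemma side_segment d (h : point d * R) (x y : point d) (t : R) :
  side h (x + t *: (y - x)) = side h x + t * (side h y - side h x).
Proof. by rewrite /side linearD linearZ linearB /=; ring. Qed.

Lemma meets_open_simplex d (h : point d * R) (v : 'I_d.+1 -> point d) (p : 'I_d.+1) :
  side h (v p) != 0 ->
  meets (hyperplane h) (open_simplex_of v) <->
  (exists i, 0 < side h (v i)) /\ (exists i, side h (v i) < 0).
Proof.
move=> vp0; apply: iff_trans (convex_combination_eq0P vp0); split.
  move=> [x [/hyperplaneE hx [lam [lam_gt0 [lam1 xE]]]]]; exists lam; split=> //.
  by rewrite -side_convex_combination // -xE.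
move=> [lam [lam_gt0 lam1 sum0]]; exists (\sum_i lam i *: v i); split; last by exists lam.
by apply/hyperplaneE; rewrite side_convex_combination.
Qed.

Lemma poly_nonroot_near0 (F : realFieldType) (p : {poly F}) (e : F) :
  p != 0 -> 0 < e -> exists t, [/\ 0 < t, t < e & ~~ root p t].
Proof.
move=> p0 e_gt0; pose rs : seq F := [seq e / j.+2%:R | j <- iota 0 (size p)].
have uniq_rs : uniq rs.
  rewrite map_inj_uniq ?iota_uniq // => i j.
  by move/(mulfI (lt0r_neq0 e_gt0))/invr_inj/eqP; rewrite eqr_nat => /eqP[].
have /allPn[_ /mapP[j _ ->] nroot] : ~~ all (root p) rs.
  apply/negP => /(max_poly_roots p0)/(_ uniq_rs).
  by rewrite size_map size_iota ltnn.
exists (e / j.+2%:R); split=> //; first by rewrite divr_gt0.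
by rewrite ltr_pdivrMr ?ltr0n // ltr_pMr // ltr1n.
Qed.

Lemma unitmx_segment_near0 (F : realFieldType) n (A B : 'M[F]_n) (e : F) :
  B \in unitmx -> 0 < e ->
  exists t, [/\ 0 < t, t < e & A + t *: (B - A) \in unitmx].
Proof.
move=> unitB e_gt0.
pose p : {poly F} := \det (map_mx polyC A + 'X *: map_mx polyC (B - A)).
have pE t : p.[t] = \det (A + t *: (B - A)).
  rewrite -horner_evalE -det_map_mx; congr (\det _); apply/matrixP => i j.
  by rewrite !mxE /= horner_evalE !hornerE.
have p0 : p != 0.
  apply: contraTneq unitB => p0.
  by rewrite unitmxE -[B](subrKC A) -[B - A]scale1r -pE p0 horner0 unitr0.
have [t [t_gt0 t_lt_e nroot]] := poly_nonroot_near0 p0 e_gt0.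
by exists t; rewrite unitmxE -pE unitfE.
Qed.

Lemma sgr_stable (F : realFieldType) (I : finType) (g h : I -> F) :
  (forall i, g i != 0) ->
  exists2 e, 0 < e &
    forall t, 0 < t -> t < e -> forall i, Num.sg (g i + t * h i) = Num.sg (g i).
Proof.
move=> g0; exists (\big[Num.min/1]_i (`|g i| / (`|h i| + 1))).
  by apply: lt_bigmin => // i _; rewrite divr_gt0 ?normr_gt0 // ltr_wpDl.
move=> t t_gt0 t_lt i; have := lt_le_trans t_lt (bigmin_le _ i _).
rewrite ltr_pdivlMr ?ltr_wpDl // mulrDr mulr1 => small.
have : `|t * h i| < `|g i| by rewrite normrM (gtr0_norm t_gt0); lra.
rewrite ltr_norml => /andP[].
have [gi|gi|gi] := ltrgt0P (g i); last by move: (g0 i); rewrite gi eqxx.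
  by move=> *; rewrite !gtr0_sg //; lra.
by move=> *; rewrite !ltr0_sg //; lra.
Qed.

Definition homog_mx d (v : 'I_d.+1 -> point d) : 'M[R]_(1 + d) :=
  row_mx (const_mx 1 : 'cV_(1 + d)) (\matrix_i v i).

Lemma aff_indep_unitmx d (v : 'I_d.+1 -> point d) : homog_mx v \in unitmx -> aff_indep v.
Proof.
move=> unit_v mu sum_mu sum_muv i.
have ker_mu : (\row_k mu k : 'rV_(1 + d)) *m homog_mx v = 0.
  rewrite /homog_mx mul_mx_row -[RHS]row_mx0; congr row_mx.
    apply/rowP => j; rewrite !mxE -[RHS]sum_mu.
    by apply: eq_bigr => k _; rewrite !mxE mulr1.
  rewrite mulmx_sum_row -[RHS]sum_muv.
  by apply: eq_bigr => k _; rewrite rowK mxE.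
have := mulmxK unit_v (\row_k mu k); rewrite ker_mu mul0mx => /rowP/(_ i).
by rewrite !mxE.
Qed.

Definition standard_simplex d (i : 'I_d.+1) : point d :=
  row i (col_mx (0 : 'rV_d) 1%:M : 'M_(1 + d, d)).

Lemma homog_standard_simplex_unitmx d : homog_mx (@standard_simplex d) \in unitmx.
Proof.
have -> : homog_mx (@standard_simplex d) = block_mx (1%:M : 'M_1) 0 (const_mx 1) 1%:M.
  rewrite block_mxEh; congr row_mx; last by apply/row_matrixP => i; rewrite rowK.
  by rewrite -[LHS]vsubmxK; congr col_mx; apply/matrixP => i j; rewrite !mxE // !ord1.
by rewrite unitmxE det_lblock !det1 mulr1 unitr1.
Qed.

Lemma homog_mx_segment d (v w : 'I_d.+1 -> point d) (t : R) :
  homog_mx (fun i => v i + t *: (w i - v i)) =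
  homog_mx v + t *: (homog_mx w - homog_mx v).
Proof.
rewrite /homog_mx opp_row_mx add_row_mx subrr scale_row_mx scaler0 add_row_mx addr0.
by congr row_mx; apply/matrixP => i j; rewrite !mxE.
Qed.

Lemma aff_indep_perturb d (I : finType) (h : I -> point d * R) (v : 'I_d.+1 -> point d) :
  (forall r i, side (h r) (v i) != 0) ->
  exists2 v', aff_indep v' &
    forall r i, Num.sg (side (h r) (v' i)) = Num.sg (side (h r) (v i)).
Proof.
move=> off; pose w := @standard_simplex d.
have [e e_gt0 stable] := @sgr_stable _ _
  (fun ri : I * 'I_d.+1 => side (h ri.1) (v ri.2))
  (fun ri => side (h ri.1) (w ri.2) - side (h ri.1) (v ri.2)) (fun ri => off ri.1 ri.2).
have [t [t_gt0 t_lt_e unit_t]] :=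
  unitmx_segment_near0 (homog_mx v) (homog_standard_simplex_unitmx d) e_gt0.
exists (fun i => v i + t *: (w i - v i)) => [|r i].
  by apply: aff_indep_unitmx; rewrite homog_mx_segment.
by rewrite side_segment; apply: (stable t t_gt0 t_lt_e (r, i)).
Qed.

Lemma open_simplex_through_points d (I J : finType) (h : I -> point d * R)
    (u0 : point d) (u : J -> point d) :
  (#|J| <= d)%N -> (forall r, 0 < side (h r) u0) ->
  (forall r j, side (h r) (u j) != 0) ->
  exists2 D, is_open_simplex D &
    forall r, meets (hyperplane (h r)) D <-> exists j, side (h r) (u j) < 0.
Proof.
move=> leJd u0_gt0 u_neq0.
pose v (i : 'I_d.+1) := if insub (i : nat) is Some k then u (@enum_val J predT k) else u0.
have v_max : v ord_max = u0 by rewrite /v insubF // ltnNge leJd.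
have v_u j : exists i, v i = u j.
  have rank_lt : (enum_rank j < d.+1)%N by apply: leq_trans (ltn_ord _) (leqW leJd).
  by exists (Ordinal rank_lt); rewrite /v valK enum_rankK.
have v_cases i : v i = u0 \/ exists j, v i = u j.
  by rewrite /v; case: insubP => [k _ _|_]; [right; exists (enum_val k)|left].
have v_neq0 r i : side (h r) (v i) != 0.
  by case: (v_cases i) => [->|[j ->//]]; rewrite gt_eqF.
have [v' v'_indep sgE] := aff_indep_perturb v_neq0.
have v'_lt0 r i : (side (h r) (v' i) < 0) = (side (h r) (v i) < 0).
  by rewrite -sgr_lt0 sgE sgr_lt0.
have v'_gt0 r : 0 < side (h r) (v' ord_max) by rewrite -sgr_gt0 sgE sgr_gt0 v_max.
exists (open_simplex_of v'); first by exists v'.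
move=> r; apply: iff_trans (meets_open_simplex (lt0r_neq0 (v'_gt0 r))) _.
split=> [[_ [i]]|[j uj_lt0]].
  rewrite v'_lt0; case: (v_cases i) => [->|[j ->]]; last by exists j.
  by rewrite lt_gtF.
have [i vi] := v_u j.
by split; [exists ord_max|exists i; rewrite v'_lt0 vi].
Qed.

(** * Butterfly networks and dyadic boxes *)

Definition bits N := {ffun 'I_N -> bool}.

Definition delete_bit n (i : 'I_n.+1) (t : bits n.+1) : bits n :=
  [ffun l => t (lift i l)].

Definition insert0 n (i : 'I_n.+1) (w : bits n) : bits n.+1 :=
  [ffun l => if unlift i l is Some l' then w l' else false].

Lemma insert0K n (i : 'I_n.+1) : cancel (insert0 i) (delete_bit i).
Proof. by move=> w; apply/ffunP => l; rewrite !ffunE liftK. Qed.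

Fixpoint butterfly n (s : 'I_n.+1 -> bits n -> bool) (k : nat) (z : bits n.+1) :
    bits n.+1 :=
  if k is k'.+1 then
    let y := butterfly s k' z in
    [ffun l => y l (+) ((l == k' :> nat) && s l (delete_bit l y))]
  else z.

Section Butterfly.
Variables (n : nat) (s : 'I_n.+1 -> bits n -> bool).

Lemma butterflySE k z (l : 'I_n.+1) :
  butterfly s k.+1 z l =
  butterfly s k z l (+) ((l == k :> nat) && s l (delete_bit l (butterfly s k z))).
Proof. by rewrite ffunE. Qed.

Lemma butterfly_late k z (l : 'I_n.+1) : (k <= l)%N -> butterfly s k z l = z l.
Proof.
elim: k => [//|k IH] lt_kl; rewrite butterflySE IH ?(ltnW lt_kl) //.
by rewrite gtn_eqF // addbF.
Qed.

Lemma butterfly_early i j z (l : 'I_n.+1) :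
  (l < i)%N -> (i <= j)%N -> butterfly s j z l = butterfly s i z l.
Proof.
move=> lt_li; elim: j => [|j IH]; first by rewrite leqn0 => /eqP ->.
rewrite leq_eqVlt => /orP[/eqP -> //|]; rewrite ltnS => le_ij.
by rewrite butterflySE IH // ltn_eqF ?addbF // (leq_trans lt_li).
Qed.

Lemma butterfly_surj k w : exists z, butterfly s k z = w.
Proof.
elim: k w => [|k IH] w; first by exists w.
have [z zE] := IH [ffun l => w l (+) ((l == k :> nat) && s l (delete_bit l w))].
exists z; apply/ffunP => l; rewrite butterflySE zE !ffunE.
have [lk /=|_] := eqVneq (l : nat) k; last by rewrite !addbF.
rewrite (_ : delete_bit l _ = delete_bit l w) ?addbK //.
by apply/ffunP => j; rewrite !ffunE -lk val_eqE eq_sym (negPf (neq_lift _ _)) addbF.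
Qed.

End Butterfly.

(* A box of the plane once [x] is read with its first bit as the most significant one,
   and [z] with its last. *)
Definition dyadic_box N (i : 'I_N) (w x z : bits N) : bool :=
  [forall l : 'I_N, ((l <= i)%N ==> (x l == w l)) && ((i <= l)%N ==> (z l == w l))].

Lemma dyadic_boxP N (i : 'I_N) (w x z : bits N) :
  reflect ((forall l : 'I_N, (l <= i)%N -> x l = w l) /\
           (forall l : 'I_N, (i <= l)%N -> z l = w l))
          (dyadic_box i w x z).
Proof.
apply: (iffP forallP) => [box|[xw zw] l].
  by split=> l il; apply/eqP; move: il; apply/implyP; case/andP: (box l).
by apply/andP; split; apply/implyP => il; apply/eqP; [apply: xw|apply: zw].
Qed.

(* A network input [z] in the box, together with its output, is in state [w] before
   stage [i], so the switch of that stage alone decides whether the box is hit. *)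
Lemma butterfly_hits_box n (s : 'I_n.+1 -> bits n -> bool) (i : 'I_n.+1) (w : bits n) :
  (exists z, dyadic_box i (insert0 i w) (butterfly s n.+1 z) z) <-> ~~ s i w.
Proof.
set w0 := insert0 i w.
have output_at_i z : butterfly s i z = w0 -> butterfly s n.+1 z i = w0 i (+) s i w.
  move=> state; rewrite (@butterfly_early _ s i.+1) //.
  by rewrite butterflySE eqxx state insert0K.
split=> [[z /dyadic_boxP[xw zw]]|off].
  have state : butterfly s i z = w0.
    apply/ffunP => l; have [li|il] := ltnP l i.
      by rewrite -(butterfly_early s z li (ltnW (ltn_ord i))) xw // ltnW.
    by rewrite butterfly_late // zw.
  by have := output_at_i z state; rewrite xw //; case: (w0 i); case: (s i w).
have [z state] := butterfly_surj s i w0.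
exists z; apply/dyadic_boxP; split=> l.
  rewrite leq_eqVlt => /orP[/eqP/val_inj ->|li].
    by rewrite output_at_i // (negPf off) addbF.
  by rewrite (butterfly_early _ _ li) ?state // ltnW.
by move=> il; rewrite -state butterfly_late.
Qed.

(** * Base-4 expansions and ellipses *)

Section Base4.
Variable F : realDomainType.

Definition base4 N (f : 'I_N -> bool) : F := \sum_l (f l)%:R * 4 ^+ l.

Lemma base4_recr N (f : 'I_N.+1 -> bool) :
  base4 f = base4 (f \o widen_ord (leqnSn N)) + (f ord_max)%:R * 4 ^+ N.
Proof. exact: big_ord_recr. Qed.

Lemma base4_ge0 N (f : 'I_N -> bool) : 0 <= base4 f.
Proof. by apply: sumr_ge0 => l _; rewrite mulr_ge0 // exprn_ge0. Qed.

Lemma base4_dist_agree N (f g : 'I_N -> bool) i :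
  (forall l : 'I_N, (i <= l)%N -> f l = g l) -> 3 * `|base4 f - base4 g| < 4 ^+ i.
Proof.
elim: N f g i => [|N IH] f g i fg.
  by rewrite /base4 !big_ord0 subrr normr0 mulr0 exprn_gt0.
rewrite !base4_recr opprD addrACA -mulrBl; have [le_iN|lt_Ni] := leqP i N.
  by rewrite (fg ord_max le_iN) subrr mul0r addr0; apply: IH => l il; exact: fg.
apply: lt_le_trans (_ : 4 ^+ N.+1 <= _); last by rewrite ler_eXn2l // ltr1n.
set low := base4 _ - base4 _; set top := (_ - _) * _.
have low_lt : 3 * `|low| < 4 ^+ N by apply: IH => l; rewrite leqNgt ltn_ord.
have norm_top : `|top| <= 4 ^+ N.
  rewrite /top normrM normrX normr_nat ler_piMl ?exprn_ge0 //.
  by case: (f _); case: (g _); rewrite ?subrr ?subr0 ?sub0r ?normrN ?normr0 ?normr1.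
by have := ler_normD low top; rewrite exprS; lra.
Qed.

(* Together with [base4_dist_agree], this leaves a gap of a factor 2, which is what
   lets an ellipse replace a box. *)
Lemma base4_dist_differ N (f g : 'I_N -> bool) i (l : 'I_N) :
  (i <= l)%N -> f l != g l -> 2 * 4 ^+ i <= 3 * `|base4 f - base4 g|.
Proof.
elim: N f g l => [|N IH] f g l; first by case: l.
rewrite !base4_recr opprD addrACA -mulrBl.
have [top_eq|top_neq] := eqVneq (f ord_max) (g ord_max).
  rewrite top_eq subrr mul0r addr0.
  case: (unliftP ord_max l) => [l' -> il fg|->]; last by rewrite top_eq eqxx.
  have lift_widen : lift ord_max l' = widen_ord (leqnSn N) l'.
    by apply: val_inj; exact: lift_max.
  by apply: (IH _ _ l'); rewrite /= -?lift_widen // -(lift_max l').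
move=> il _; set low := base4 _ - base4 _; set top := (_ - _) * _.
have le4 : 4 ^+ i <= 4 ^+ N :> F.
  by rewrite ler_eXn2l ?ltr1n // (leq_trans il) // -ltnS.
have low_lt : 3 * `|low| < 4 ^+ N.
  by apply: base4_dist_agree => k; rewrite leqNgt ltn_ord.
have norm_top : `|top| = 4 ^+ N.
  rewrite /top normrM normrX normr_nat.
  move: top_neq; case: (f _); case: (g _);
  by rewrite // ?subr0 ?sub0r ?normrN normr1 mul1r.
by have := lerB_normD top low; rewrite addrC; lra.
Qed.

End Base4.

Section PlanarEllipses.
Variable F : realFieldType.

(* The ellipse of center [c] and half-axes [p / sqrt 3], [q / sqrt 3]. *)
Definition ellipse_eqn (c : F * F) (p q : F) (x : F * F) : F :=
  ((x.1 - c.1) / p) ^+ 2 + ((x.2 - c.2) / q) ^+ 2 - 3^-1.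

Lemma ellipse_eqn_lt0 (c : F * F) (p q : F) (x : F * F) : 0 < p -> 0 < q ->
  3 * `|x.1 - c.1| < p -> 3 * `|x.2 - c.2| < q -> ellipse_eqn c p q x < 0.
Proof.
have sq (u v : F) : 0 < v -> 3 * `|u| < v -> 9 * (u / v) ^+ 2 < 1.
  move=> v_gt0 uv; have : `|u / v| < 3^-1.
    by rewrite normrM normfV (gtr0_norm v_gt0) ltr_pdivrMr //; lra.
  by rewrite -[_ ^+ 2]real_normK ?num_real //; have := normr_ge0 (u / v); nra.
by rewrite /ellipse_eqn => p_gt0 q_gt0 /(sq _ _ p_gt0) ? /(sq _ _ q_gt0) ?; lra.
Qed.

Lemma ellipse_eqn_gt0 (c : F * F) (p q : F) (x : F * F) : 0 < p -> 0 < q ->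
  2 * p <= 3 * `|x.1 - c.1| \/ 2 * q <= 3 * `|x.2 - c.2| -> 0 < ellipse_eqn c p q x.
Proof.
have sq (u v : F) : 0 < v -> 2 * v <= 3 * `|u| -> 4 <= 9 * (u / v) ^+ 2.
  move=> v_gt0 uv; have : 2 / 3 <= `|u / v|.
    by rewrite normrM normfV (gtr0_norm v_gt0) ler_pdivlMr //; lra.
  by rewrite -[_ ^+ 2]real_normK ?num_real //; nra.
rewrite /ellipse_eqn => p_gt0 q_gt0 [/(sq _ _ p_gt0)|/(sq _ _ q_gt0)] ?;
  by have := sqr_ge0 ((x.1 - c.1) / p); have := sqr_ge0 ((x.2 - c.2) / q); lra.
Qed.

Definition bit_point N (x z : bits N) : F * F := (base4 F (x \o @rev_ord N), base4 F z).

Definition box_ellipse N (i : 'I_N) (w : bits N) : F * F -> F :=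
  ellipse_eqn (bit_point w w) (4 ^+ rev_ord i) (4 ^+ i).

Lemma box_ellipse_lt0 N (i : 'I_N) (w x z : bits N) :
  dyadic_box i w x z -> box_ellipse i w (bit_point x z) < 0.
Proof.
move=> /dyadic_boxP[xw zw]; apply: ellipse_eqn_lt0; rewrite ?exprn_gt0 //=.
  apply: base4_dist_agree => l il; apply: xw.
  by rewrite -[i]rev_ordK /= leq_sub2l.
exact: base4_dist_agree.
Qed.

Lemma box_ellipse_gt0 N (i : 'I_N) (w x z : bits N) :
  ~~ dyadic_box i w x z -> 0 < box_ellipse i w (bit_point x z).
Proof.
move=> /forallPn[l]; rewrite negb_and !negb_imply => differ.
apply: ellipse_eqn_gt0; rewrite ?exprn_gt0 //=.
case/orP: differ => /andP[il neq]; [left|right]; last exact: base4_dist_differ neq.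
by apply: (@base4_dist_differ _ _ _ _ _ (rev_ord l)); rewrite /= ?rev_ordK // leq_sub2l.
Qed.

Lemma box_ellipse_far N (i : 'I_N) (w : bits N) : 0 < box_ellipse i w (- 4 ^+ N, 0).
Proof.
apply: ellipse_eqn_gt0; rewrite ?exprn_gt0 //; left.
have center_ge0 := base4_ge0 F (w \o @rev_ord N).
have le4 : 4 ^+ rev_ord i <= 4 ^+ N :> F by rewrite ler_eXn2l ?ltr1n // leq_subr.
have pow_gt0 : 0 < 4 ^+ N :> F by rewrite exprn_gt0.
by rewrite ler0_norm /=; lra.
Qed.

Lemma box_ellipses_shattered n (e : 'I_n.+1 -> bits n -> bool) :
  exists P : bits n.+1 -> F * F,
    (forall z (i : 'I_n.+1) w, box_ellipse i (insert0 i w) (P z) != 0) /\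
    (forall i w, e i w <-> exists z, box_ellipse i (insert0 i w) (P z) < 0).
Proof.
pose s i w := ~~ e i w.
exists (fun z => bit_point (butterfly s n.+1 z) z); split=> [z i w|i w].
  set x := butterfly _ _ _.
  have [in_box|off_box] := boolP (dyadic_box i (insert0 i w) x z).
    by rewrite lt_eqF // box_ellipse_lt0.
  by rewrite gt_eqF // box_ellipse_gt0.
rewrite -[e i w]negbK; apply: iff_trans (iff_sym (butterfly_hits_box s i w)) _.
split=> -[z hit]; exists z; first exact: box_ellipse_lt0.
by apply: contraLR hit => off_box; rewrite -leNgt ltW // box_ellipse_gt0.
Qed.

End PlanarEllipses.

(** * Hyperplanes supported on blocks of coordinates *)

Lemma dotp_block d (k b : nat) (g : nat -> R) (h : nat -> nat -> R) :
  (0 < k)%N -> (k * b.+1 <= d)%N ->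
  dotp (\row_(l < d) ((l %/ k == b)%N%:R * g (l %% k)%N))
       (\row_(l < d) h (l %/ k)%N (l %% k)%N) = \sum_(j < k) g j * h b j.
Proof.
move=> k_gt0 le_d.
pose f l := g (l %% k)%N * h (l %/ k)%N (l %% k)%N.
have blockE l : (l %/ k == b)%N = (k * b <= l < k * b.+1)%N.
  by rewrite eqn_leq -ltnS ltn_divLR // leq_divRL // andbC !(mulnC k).
transitivity (\sum_(k * b <= l < k * b.+1) f l).
  rewrite (big_nat_widenl _ 0) // (big_nat_widen _ _ d) // big_mkord big_mkcond /=.
  apply: eq_bigr => l _; rewrite !mxE blockE -mulrA.
  by case: ifP => _; rewrite ?mul1r ?mul0r.
rewrite mulnSr -{1}[(k * b)%N]add0n big_addn addKn big_mkord.
apply: eq_bigr => j _; rewrite /f.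
by rewrite addnC mulnC modnMDl divnMDl // modn_small // divn_small // addn0.
Qed.

(* In these coordinates, an axis-parallel ellipse is a half-space. *)
Definition quad_coords (x : R * R) : seq R := [:: x.1 ^+ 2; x.1; x.2 ^+ 2; x.2].

Definition lift_blocks d m (P : 'I_m -> R * R) : point d :=
  \row_(l < d) oapp (fun b => (quad_coords (P b))`_(l %% 4)) 0 (insub (l %/ 4)%N).

Definition ellipse_coefs (c : R * R) (p q : R) : seq R :=
  [:: p ^- 2; - 2 * c.1 / p ^+ 2; q ^- 2; - 2 * c.2 / q ^+ 2].

Definition ellipse_hyperplane d (b : nat) (c : R * R) (p q : R) : point d * R :=
  (\row_(l < d) ((l %/ 4 == b)%N%:R * (ellipse_coefs c p q)`_(l %% 4)),
   3^-1 - (c.1 / p) ^+ 2 - (c.2 / q) ^+ 2).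

Lemma side_ellipse_hyperplane d m (P : 'I_m -> R * R) (b : 'I_m) (c : R * R) (p q : R) :
  (4 * m <= d)%N -> p != 0 -> q != 0 ->
  side (ellipse_hyperplane d b c p q) (lift_blocks d P) = ellipse_eqn c p q (P b).
Proof.
move=> le_d p0 q0; rewrite /side (@dotp_block d 4 b (nth 0 (ellipse_coefs c p q))
  (fun b' j => oapp (fun b => (quad_coords (P b))`_j) 0 (insub b'))) //.
  rewrite valK !big_ord_recl big_ord0 /= /ellipse_eqn.
  by field; rewrite p0 q0.
by apply: leq_trans le_d; rewrite leq_mul2l ltn_ord orbT.
Qed.

Lemma is_hyperplane_ellipse d (b : nat) (c : R * R) (p q : R) :
  (4 * b < d)%N -> p != 0 -> is_hyperplane (hyperplane (ellipse_hyperplane d b c p q)).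
Proof.
move=> lt_d p0; set h := ellipse_hyperplane d b c p q.
exists h.1, h.2; split=> //.
apply/negP => /eqP/rowP/(_ (Ordinal lt_d)); rewrite !mxE /= mulKn // modnMr eqxx mul1r.
by apply/eqP; rewrite invr_eq0 expf_neq0.
Qed.

Definition box_index m n := ('I_m * 'I_n.+1 * bits n)%type.

Lemma card_box_index m n : #|{: box_index m n}| = (m * n.+1 * 2 ^ n)%N.
Proof. by rewrite !card_prod card_ffun card_bool !card_ord. Qed.

Definition box_hyperplane d m n (r : box_index m n) : point d * R :=
  let: (b, i, w) := r in
  ellipse_hyperplane d b (bit_point R (insert0 i w) (insert0 i w))
    (4 ^+ rev_ord i) (4 ^+ i).

Section BoxHyperplanes.
Variables (d m n : nat).
Hypothesis le_blocks : (4 * m <= d)%N.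

Lemma side_box_hyperplane (P : 'I_m -> R * R) b i (w : bits n) :
  side (box_hyperplane d (b, i, w)) (lift_blocks d P) = box_ellipse i (insert0 i w) (P b).
Proof. by rewrite side_ellipse_hyperplane // expf_neq0 // pnatr_eq0. Qed.

Lemma is_hyperplane_box (r : box_index m n) :
  is_hyperplane (hyperplane (box_hyperplane d r)).
Proof.
case: r => [[b i] w]; apply: is_hyperplane_ellipse.
  by apply: leq_trans le_blocks; rewrite ltn_mul2l ltn_ord.
by rewrite expf_neq0 // pnatr_eq0.
Qed.

Lemma open_simplex_box_trace (e : pred (box_index m n)) : (2 ^ n.+1 <= d)%N ->
  exists2 D, is_open_simplex D &
    forall r, meets (hyperplane (box_hyperplane d r)) D <-> e r.
Proof.
move=> le_vertices.
have /choice[P P_spec] := fun b => box_ellipses_shattered R (fun i w => e (b, i, w)).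
have [|[[b i] w]|[[b i] w] z|D simplexD traceD] :=
  @open_simplex_through_points d _ (bits n.+1) (@box_hyperplane d m n)
    (lift_blocks d (fun _ : 'I_m => (- 4 ^+ n.+1, 0))) (fun z => lift_blocks d (P^~ z)).
- by rewrite card_ffun card_bool card_ord.
- by rewrite side_box_hyperplane box_ellipse_far.
- by rewrite side_box_hyperplane; case: (P_spec b) => + _; apply.
exists D => // -[[b i] w]; apply: iff_trans (traceD _) _.
have [_ shattered] := P_spec b; apply: iff_trans (iff_sym (shattered i w)).
by split=> -[z lt0]; exists z; rewrite side_box_hyperplane in lt0 *.
Qed.

End BoxHyperplanes.

(** * Shattered finite families *)

Lemma InP (T : eqType) (x : T) (s : seq T) : reflect (List.In x s) (x \in s).
Proof.
elim: s => [|y s IH] /=; first exact: ReflectF.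
rewrite inE eq_sym.
by apply: (iffP orP) => -[/eqP|/IH]; [left|right|left|right].
Qed.

Lemma uniq_NoDup (T : eqType) (s : seq T) : uniq s -> List.NoDup s.
Proof.
elim: s => [|x s IH] /=; first by constructor.
by move=> /andP[/InP x_notin /IH]; constructor.
Qed.

Lemma In_codom (I : finType) (T : Type) (f : I -> T) (y : T) :
  List.In y (codom f) <-> exists i, y = f i.
Proof.
apply: iff_trans (List.in_map_iff f _ y) _.
split=> [[i [<- _]]|[i ->]]; exists i => //; split=> //.
by apply/InP; rewrite mem_enum.
Qed.

Lemma NoDup_codom (I : finType) (T : Type) (f : I -> T) :
  injective f -> List.NoDup (codom f).
Proof.
move=> f_inj; apply: List.NoDup_map_NoDup_ForallPairs => [i j _ _ /f_inj //|].
exact/uniq_NoDup/enum_uniq.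
Qed.

Section FiniteFamily.
Variables (d : nat) (I : finType) (h : I -> point d -> Prop).

Definition members (g : point d -> Prop) : Prop := exists i, g = h i.

Lemma simplex_shatters_members :
  (forall e : pred I, exists2 D, is_open_simplex D & forall i, meets (h i) D <-> e i) ->
  simplex_shatters members (codom h).
Proof.
move=> trace; split; [|split=> [g /In_codom //|Q]].
  apply: NoDup_codom => i j hij; apply/eqP; have [D _ traceD] := trace (eq_op i).
  by apply/traceD; rewrite -hij; apply/traceD.
have [D simplexD traceD] := trace (fun i => `[< Q (h i) >]).
by exists D; split=> // g /In_codom[i ->]; rewrite traceD asboolE.
Qed.

Lemma simplex_shatters_members_size Y : simplex_shatters members Y -> (size Y <= #|I|)%N.
Proof.
move=> [uniqY [sub _]]; rewrite -(size_codom h).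
by apply/ssrnat.leP/(List.NoDup_incl_length uniqY) => g /sub/In_codom.
Qed.

End FiniteFamily.

(** * The number of boxes *)

Lemma ltr_ln (x y : R) : 0 < x -> x < y -> Rpower.ln x < Rpower.ln y.
Proof. by move=> /RltP x_gt0 /RltP lt_xy; apply/RltP/Rpower.ln_increasing. Qed.

Lemma ln2_gt0 : 0 < Rpower.ln 2 :> R.
Proof. by rewrite -[0]Rpower.ln_1 ltr_ln // ltr1n. Qed.

Lemma ler_log2 (x y : R) : 0 < x -> x <= y -> log2 x <= log2 y.
Proof.
move=> x_gt0; rewrite le_eqVlt => /predU1P[-> //|lt_xy].
by rewrite ler_pM2r ?invr_gt0 ?ln2_gt0 // ltW // ltr_ln.
Qed.

Lemma log2_exp n : log2 (2 ^+ n) = n%:R.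
Proof.
rewrite /log2 RdivE -RpowE Rpower.ln_pow; last by apply/RltP.
by rewrite INRE; apply: mulfK; rewrite gt_eqF // ln2_gt0.
Qed.

Lemma log2_trunc_log (d : nat) : (0 < d)%N ->
  (trunc_log 2 d)%:R <= log2 d%:R <= (trunc_log 2 d).+1%:R.
Proof.
move=> d_gt0; have /andP[lo hi] := trunc_log_bounds (isT : (1 < 2)%N) d_gt0.
set k := trunc_log 2 d; rewrite -(log2_exp k) -(log2_exp k.+1).
by rewrite !ler_log2 ?exprn_gt0 ?ltr0n // -natrX ler_nat // ltnW.
Qed.

Lemma box_count_ge (d n : nat) : (4 <= d)%N -> trunc_log 2 d = n.+1 ->
  56^-1 * d%:R ^+ 2 * log2 d%:R <= (d %/ 4 * n.+1 * 2 ^ n)%:R.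
Proof.
move=> d_ge4 nE.
have d_gt0 : (0 < d)%N by apply: leq_trans d_ge4.
have /andP[_] := trunc_log_bounds (isT : (1 < 2)%N) d_gt0.
have /andP[log_ge log_le] := log2_trunc_log d_gt0; rewrite nE in log_ge log_le *.
rewrite !expnS => d_lt.
have d_le_blocks : d%:R <= 7 * (d %/ 4)%:R :> R by rewrite -natrM ler_nat; lia.
have d_le_pow : d%:R <= 4 * (2 ^ n)%:R :> R by rewrite -natrM ler_nat; lia.
have log_le2 : log2 d%:R <= 2 * n.+1%:R.
  by apply: le_trans log_le _; rewrite -natrM ler_nat; lia.
have log_ge0 : 0 <= log2 d%:R by apply: le_trans log_ge.
have := ler_pM (mulr_ge0 (ler0n _ d) (ler0n _ d)) log_ge0
  (ler_pM (ler0n _ d) (ler0n _ d) d_le_blocks d_le_pow) log_le2.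
by rewrite !natrM expr2; lra.
Qed.

Lemma box_count_le (d n : nat) : (0 < d)%N -> trunc_log 2 d = n.+1 ->
  (d %/ 4 * n.+1 * 2 ^ n)%:R <= d%:R ^+ 2 * log2 d%:R.
Proof.
move=> d_gt0 nE.
have /andP[] := trunc_log_bounds (isT : (1 < 2)%N) d_gt0.
have /andP[log_ge _] := log2_trunc_log d_gt0; rewrite nE in log_ge *.
rewrite expnS => pow_le _.
rewrite mulnAC natrM ler_pM // -natrX ler_nat leq_mul //; lia.
Qed.

Theorem theorem2 :
  exists c C : R, 0 < c /\ 0 < C /\
  forall d : nat, (4 <= d)%N ->
  exists H : (point d -> Prop) -> Prop,
    (forall h, H h -> is_hyperplane h) /\
    (exists Y, simplex_shatters H Y /\
       c * (d%:R) ^+ 2 * log2 d%:R <= (size Y)%:R) /\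
    (forall Y, simplex_shatters H Y ->
       (size Y)%:R <= C * (d%:R) ^+ 2 * log2 d%:R).
Proof.
exists 56^-1, 1; split; [by rewrite invr_gt0|split=> // d d_ge4].
have d_gt0 : (0 < d)%N by apply: leq_trans d_ge4.
have [n nE] : exists n, trunc_log 2 d = n.+1.
  by exists (trunc_log 2 d).-1; rewrite prednK // trunc_log_gt0 (leq_trans _ d_ge4).
have le_blocks : (4 * (d %/ 4) <= d)%N by rewrite mulnC leq_trunc_div.
have le_vertices : (2 ^ n.+1 <= d)%N by rewrite -nE trunc_logP.
pose h (r : box_index (d %/ 4) n) := hyperplane (box_hyperplane d r).
exists (members h); split; [|split].
- by move=> _ [r ->]; apply: is_hyperplane_box.
- exists (codom h); split.
    by apply: simplex_shatters_members => e; apply: open_simplex_box_trace.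
  by rewrite size_codom card_box_index box_count_ge.
- move=> Y /simplex_shatters_members_size; rewrite card_box_index mul1r => le_size.
  by apply: le_trans (box_count_le d_gt0 nE); rewrite ler_nat.
Qed.
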